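(* Let $N\ge 2$, let $\Omega\subset\mathbb{R}^N$ be a bounded smooth domain, let $a>0$, $b>0$, $0<\alpha<\frac{2^*-1}{2}$ and $0<p<1$. Let $h:\overline\Omega\times\mathbb{R}\times\mathbb{R}^N\to\mathbb{R}$, $(x,s,\xi)\mapsto h(x,s,\xi)$, satisfy: - for $s>0$, $h(x,s,\xi)$ is Hölder continuous and $h(x,s,\xi)\ge 0$; - $\lim_{s\to 0^+}\frac{h(x,s,\xi)}{s^p}=0$ uniformly in $x$ and $\xi$, and there are constants $C>0$ and $q,q_1$ with $p<q\le q_1<1$ such that $|h(x,s,\xi)|\le C(s^q+s^{q_1})$ for all $s>0$ and all $x,\xi$. For $t\in[0,1]$ consider the problem $$(P_t)\qquad -(a+tb\|\nabla u\|_2^{2\alpha})\Delta u=u^p+t\,h(x,u,\nabla u)\ \text{ in }\Omega,\qquad u>0\ \text{ in }\Omega,\qquad u=0\ \text{ on }\partial\Omega .$$ Then there exist positive constants $r$ and $R$, independent of $t\in[0,1]$ and of the solution, such that every solution $u\in C^2(\Omega)\cap C(\overline\Omega)$ of $(P_t)$ satisfies $r\le\|u\|_{C(\Omega)}\le R$.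
   Context: $\|\nabla u\|_2$ is the $L^2(\Omega)$ norm of $|\nabla u|$ (finite for solutions). $\|u\|_{C(\Omega)}=\sup_{x\in\Omega}|u(x)|$. $2^*=+\infty$ if $N=2$ and $2^*=\frac{N+2}{N-2}$ if $N\ge 3$. *)

(* Defs.v *)
From HB Require Import structures.
From mathcomp Require Import all_boot all_order all_algebra.
From mathcomp Require Import all_classical all_reals all_analysis.

Set Implicit Arguments.
Unset Strict Implicit.
Unset Printing Implicit Defensive.

Import Order.TTheory GRing.Theory Num.Theory.
Import numFieldNormedType.Exports.

Local Open Scope classical_set_scope.
Local Open Scope ring_scope.

(* Points of R^N are row vectors.  Their library norm is the sup norm, which
   gives the usual topology; enorm below is the Euclidean norm. *)

Section differential_operators.
Context {R : realType} {n : nat}.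
Implicit Types (f : 'rV[R]_n -> R) (A : set 'rV[R]_n) (x v : 'rV[R]_n).

Definition enorm v : R := Num.sqrt (\sum_(i < n) v 0 i ^+ 2).

Definition partial (i : 'I_n) f x : R := 'D_(delta_mx 0 i) f x.

Definition grad f x : 'rV[R]_n := \row_(i < n) partial i f x.

Definition laplacian f x : R := \sum_(i < n) partial i (partial i f) x.

(* Meant for open A: partial derivatives at a point of A are two-sided. *)
Fixpoint Ck_on (k : nat) A f : Prop :=
  (forall x, A x -> {for x, continuous f}) /\
  match k with
  | 0 => True
  | k'.+1 => forall i : 'I_n,
      (forall x, A x -> derivable f x (delta_mx 0 i)) /\ Ck_on k' A (partial i f)
  end.

Definition smooth f : Prop := forall k, Ck_on k setT f.

End differential_operators.

(* Near each boundary point, some coordinate x_j and some orientation exhibit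
   Om as the part of R^n strictly above, or strictly below, the graph of a
   smooth function of the other n - 1 coordinates (collected in col' j x). *)
Definition smooth_boundary {R : realType} {n : nat} (Om : set 'rV[R]_n) : Prop :=
  forall x0, (closure Om `\` Om) x0 ->
    exists (j : 'I_n) (below : bool) (g : 'rV[R]_n.-1 -> R),
      smooth g /\
      \forall x \near x0, Om x <-> 0 < (-1) ^+ below * (x 0 j - g (col' j x)).

Record bounded_smooth_domain {R : realType} {n : nat} (Om : set 'rV[R]_n) : Prop := {
  domain_nonempty : Om !=set0;
  domain_open : open Om;
  domain_connected : connected Om;
  domain_bounded : bounded_set Om;
  domain_smooth : smooth_boundary Om
}.

Section lebesgue_measure_Rn.
Context {R : realType}.

Definition cons_pair (n : nat)
    (tx : n.-tuple (measurableTypeR R) * measurableTypeR R) :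
    n.+1.-tuple (measurableTypeR R) :=
  [tuple of tx.2 :: tx.1].

Lemma measurable_cons_pair (n : nat) :
  measurable_fun [set: n.-tuple (measurableTypeR R) * measurableTypeR R]
    (@cons_pair n).
Proof. exact: measurable_cons. Qed.

(* As a set function this is pushforward (mu \x lebesgue_measure) cons_pair;
   the long name is that of the library's measure instance for pushforward. *)
Definition cons_measure (n : nat)
    (mu : {measure set (n.-tuple (measurableTypeR R)) -> \bar R}) :
    {measure set (n.+1.-tuple (measurableTypeR R)) -> \bar R} :=
  measure_function_pushforward__canonical__measure_function_Measure
    (mu \x @lebesgue_measure R)%E (@measurable_cons_pair n).

(* Lebesgue measure on R^n, as an n-fold product; at n = 0 it is the unit mass
   at the empty tuple.  It lives on tuples, which carry the product
   sigma-algebra in the library. *)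
Fixpoint lebesgue_tuple (n : nat) :
    {measure set (n.-tuple (measurableTypeR R)) -> \bar R} :=
  match n with
  | 0 => \d_([tuple] : 0.-tuple (measurableTypeR R))
  | n'.+1 => cons_measure (lebesgue_tuple n')
  end.

Definition rV_of_tuple (n : nat) (s : n.-tuple (measurableTypeR R)) : 'rV[R]_n :=
  \row_(i < n) tnth s i.

End lebesgue_measure_Rn.

Definition L2norm {R : realType} {n : nat} (Om : set 'rV[R]_n)
    (f : 'rV[R]_n -> R) : \bar R :=
  Lnorm (lebesgue_tuple n) 2%:E
    (fun s => (f (rV_of_tuple s) * \1_Om (rV_of_tuple s))%:E).

Definition supnorm {R : realType} {n : nat} (Om : set 'rV[R]_n)
    (u : 'rV[R]_n -> R) : R :=
  sup [set `|u x| | x in Om].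

Definition two_star (R : realType) (N : nat) : \bar R :=
  if (N == 2)%N then +oo%E else ((N + 2)%:R / (N - 2)%:R)%:E.

(* The distance is that of the library norm of V; on a product of copies of
   R^n it is equivalent to the Euclidean one, so the notion is the usual one. *)
Definition hoelder_on {R : realType} {V : normedModType R} (A : set V)
    (f : V -> R) : Prop :=
  exists gamma L : R, [/\ 0 < gamma, gamma <= 1 &
    forall y z, A y -> A z -> `|f y - f z| <= L * `|y - z| `^ gamma].

(* Only the values of u on the closure of Om matter. *)
Record is_solution {R : realType} {N : nat} (Om : set 'rV[R]_N)
    (a b alpha p : R) (h : 'rV[R]_N -> R -> 'rV[R]_N -> R) (t : R)
    (u : 'rV[R]_N -> R) : Prop := {
  sol_C2 : Ck_on 2 Om u;
  sol_C0 : {within closure Om, continuous u};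
  sol_grad_L2 : (L2norm Om (fun x => enorm (grad u x)) < +oo)%E;
  sol_eq : forall x, Om x ->
    - (a + t * b * fine (L2norm Om (fun x => enorm (grad u x))) `^ (2 * alpha))
      * laplacian u x
    = u x `^ p + t * h x (u x) (grad u x);
  sol_pos : forall x, Om x -> 0 < u x;
  sol_boundary : forall x, (closure Om `\` Om) x -> u x = 0
}.

(* Main.v *)
(* Write m = a + t b |grad u|_2^(2 alpha) >= a and S = sup u.
   Upper bound: -Lap u <= F/a with F = S^p + C (S^q + S^q1), so comparing u with
   a multiple of a concave paraboloid gives S <= K F, and all exponents are < 1.
   Bound on m: for H(s) = ((s - e)^+)^2 / s the field H(u) grad u is C^1 with
   compact support in Om, so its divergence has integral 0; letting e -> 0 gives
   int |grad u|^2 <= S (F/a) |box|, hence m <= m0 with m0 independent of u and t.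
   Lower bound: -m0 Lap u >= u^p.  On a ball of Om put w = rho^2 - |x - x0|^2 and
   let y maximise w^2 / u.  The second derivative test at y bounds w(y) from
   below and then w(y)^2 / u(y) from above, because p < 1. *)
Require Import Defs.
From HB Require Import structures.
From mathcomp Require Import all_boot all_order all_algebra.
From mathcomp Require Import all_classical all_reals all_analysis.
From mathcomp Require Import measurable_realfun ring lra.

Set Implicit Arguments.
Unset Strict Implicit.
Unset Printing Implicit Defensive.

Import Order.TTheory GRing.Theory Num.Theory.
Import numFieldNormedType.Exports.

Local Open Scope classical_set_scope.
Local Open Scope ring_scope.

(** The coefficient is nonlocal, so for a given solution it is just an unknown number [m]. Its lower
    bound [a] is immediate and serves the upper estimate, whereas the lower estimate needs [m]
    bounded above, hence the energy, hence sup u: this fixes the order of the three bounds.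
    Truncating at height e confines the field to the compact set where u >= e, and its divergence
    can be integrated one coordinate line at a time. The weight in the lower bound is [w ^ 2] and
    not [w], because the Laplacian of w^2 contains 2 |grad w|^2. That term dominates near the
    sphere, where w is small, and so keeps the maximum point y away from it; with the first power
    nothing would bound w(y) from below. *)

(** * Second derivative test along a line *)

Lemma is_derive_line {R : realType} {V : normedModType R} (f : V -> R)
    (x v : V) (s : R) :
  derivable f (x + s *: v) v ->
  is_derive s 1 (fun t : R => f (x + t *: v)) ('D_v f (x + s *: v)).
Proof.
have E : (fun h : R => h^-1 *: (f (x + (h *: (1 : R) + s) *: v) - f (x + s *: v))) =
    (fun h : R => h^-1 *: (f (h *: v + (x + s *: v)) - f (x + s *: v))).
  apply/funext => h; congr (_ *: (f _ - _)).
  by rewrite [_ *: 1]mulr1 scalerDl addrCA.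
by move=> df; split; rewrite /derivable/derive/= E.
Qed.

(** If k < d, then g1 grows faster than k s on both sides of 0, which makes g s + g (- s) - k s^2
    strictly increasing for small s > 0, against the bound on second differences. Only
    differentiability of [g1] at 0 is used, so no Taylor formula of order two is called for. *)
Lemma second_derive_le {R : realType} (g g1 : R -> R) (d k : R) :
  (\forall s \near (0 : R), is_derive (s : R) (1 : R) g (g1 s)) ->
  is_derive (0 : R) (1 : R) g1 d ->
  (\forall s \near (0 : R), g s + g (- s) - 2 * g 0 <= k * s ^+ 2) ->
  d <= k.
Proof.
move=> dg [dg1 dval] gk; rewrite leNgt; apply/negP => kd.
have dg1k : \forall h \near (0 : R)^', k < h^-1 *: (g1 (h *: (1 : R) + 0) - g1 0).
  by apply: (cvgr_gt ('D_(1 : R) g1 (0 : R))); [exact: dg1|rewrite dval].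
have [e /= e0 He] : exists2 e : R, 0 < e & forall s, `|s| < e ->
    [/\ is_derive (s : R) (1 : R) g (g1 s), s != 0 -> k < s^-1 * (g1 s - g1 0) &
        g s + g (- s) - 2 * g 0 <= k * s ^+ 2].
  move: dg gk dg1k => /nbhs_ballP[e1 /= e10 H1] /nbhs_ballP[e2 /= e20 H2] /nbhs_ballP[e3 /=
    e30 H3].
  exists (Num.min e1 (Num.min e2 e3)); first by rewrite !lt_min e10 e20.
  move=> s; rewrite !lt_min => /and3P[s1 s2 s3]; split.
  - by apply: H1; rewrite /ball/= sub0r normrN.
  - move=> s_neq0; have := H3 s; rewrite [s *: 1]mulr1 addr0; apply => //.
    by rewrite /ball/= sub0r normrN.
  - by apply: H2; rewrite /ball/= sub0r normrN.
pose phi s := g s + g (- s) - k * s ^+ 2.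
pose phi1 s := g1 s - g1 (- s) - k * (2 * s).
have dphi s : `|s| < e -> is_derive (s : R) (1 : R) phi (phi1 s).
  move=> se; have [ds _ _] := He s se.
  have [|dNs _ _] := He (- s); first by rewrite normrN.
  have dgN : is_derive (s : R) (1 : R) (g \o -%R) (- g1 (- s)).
    by apply: is_derive_eq; rewrite mulrN1.
  rewrite (_ : phi = g + (g \o -%R) - k *: (id ^+ 2 : R -> R)); last exact/funext.
  apply: is_derive_eq; rewrite /phi1 /GRing.scale/=; ring.
pose b := e / 2.
have b0 : 0 < b by rewrite divr_gt0.
have be : b < e by rewrite /b; lra.
have [||c] := @MVT R phi phi1 0 b b0.
- by move=> x; rewrite in_itv/= => /andP[x0 xb]; apply: dphi; rewrite gtr0_norm//; lra.
- apply/derivable_within_continuous => x; rewrite in_itv/= => /andP[x0 xb].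
  by have [] : is_derive (x : R) (1 : R) phi (phi1 x) by apply: dphi; rewrite ger0_norm//;
    lra.
rewrite in_itv/= => /andP[c0 cb]; rewrite subr0 => phib.
have phi1c : 0 < phi1 c.
  have ce : c < e by lra.
  have [|_ + _] := He c; first by rewrite gtr0_norm.
  have [|_ + _] := He (- c); first by rewrite normrN gtr0_norm.
  rewrite oppr_eq0 gt_eqF// => /(_ isT) h1 /(_ isT) h2.
  rewrite invrN mulNr ltrNr mulrC ltr_pdivrMr// in h1.
  rewrite mulrC ltr_pdivlMr// in h2.
  rewrite /phi1; lra.
have [|_ _] := He b; first by rewrite gtr0_norm.
have : 0 < phi b - phi 0 by rewrite phib mulr_gt0.
by rewrite /phi oppr0; lra.
Qed.

Lemma nbhs_rVP {R : realType} {n : nat} (x : 'rV[R]_n) (A : set 'rV[R]_n) :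
  nbhs x A <->
  exists2 e : R, 0 < e & forall y : 'rV[R]_n, (forall i, `|x 0 i - y 0 i| < e) -> A y.
Proof.
split.
  move=> /nbhs_ballP[e /= e0 h]; exists e => // y xy; apply: h; split=> // i j.
  by rewrite ord1; exact: xy.
move=> [e e0 h]; apply/nbhs_ballP; exists e => //= y [_ xy].
by apply: h => i; exact: xy.
Qed.

Lemma derive2_le {R : realType} {V : normedModType R} (f : V -> R)
    (x v : V) (k : R) :
  (\forall y \near x, derivable f y v) -> derivable ('D_v f) x v ->
  (\forall s \near (0 : R),
    f (x + s *: v) + f (x - s *: v) - 2 * f x <= k * s ^+ 2) ->
  'D_v ('D_v f) x <= k.
Proof.
move=> df ddf fk.
have line : (fun s : R => x + s *: v) @ (0 : R) --> x.
  rewrite -[X in _ --> X]addr0; apply: cvgD; first exact: cvg_cst.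
  by rewrite -[X in _ --> X](scale0r v); apply: cvgZr_tmp; exact: cvg_id.
apply: (@second_derive_le R (fun s => f (x + s *: v))
  (fun s => 'D_v f (x + s *: v))).
- have H := line _ df; near=> s; apply: is_derive_line; near: s; exact: H.
- have := @is_derive_line R V ('D_v f) x v 0; rewrite scale0r addr0 => h; exact: h.
- near=> s; rewrite scale0r addr0 scaleNr; near: s; exact: fk.
Unshelve. all: by end_near. Qed.

Lemma derive2_ge {R : realType} {V : normedModType R} (f : V -> R)
    (x v : V) (k : R) :
  (\forall y \near x, derivable f y v) -> derivable ('D_v f) x v ->
  (\forall s \near (0 : R),
    k * s ^+ 2 <= f (x + s *: v) + f (x - s *: v) - 2 * f x) ->
  k <= 'D_v ('D_v f) x.
Proof.
move=> df ddf fk.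
(* The derivative commutes with the opposite only where f is derivable, so the two derivative
   functions are compared near x and not globally. *)
have dN : \forall y \near x, - 'D_v f y = 'D_v (- f) y.
  by near=> y; rewrite deriveN//; near: y.
have ddN : is_derive x v ('D_v (- f)) (- 'D_v ('D_v f) x).
  apply: (near_eq_is_derive (f := - 'D_v f) dN).
  by apply: DeriveDef; [exact: derivableN|rewrite deriveN].
rewrite -lerN2 -(@derive_val _ _ _ _ _ _ _ ddN).
apply: derive2_le.
- by near=> y; apply: derivableN; near: y.
- by case: ddN.
- near=> s; rewrite /= !fctE mulNr.
  suff : k * s ^+ 2 <= f (x + s *: v) + f (x - s *: v) - 2 * f x by lra.
  by near: s.
Unshelve. all: by end_near. Qed.

Lemma bounded_closure {R : realType} {V : normedModType R} (A : set V) :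
  bounded_set A -> bounded_set (closure A).
Proof.
move=> [M [Mr AM]]; exists M; split=> // M1 MM1 x.
have cl : closed ((fun x : V => `|x|) @^-1` [set r | r <= M1]).
  by apply: closed_comp; [move=> y _; exact: norm_continuous|exact: closed_le].
have : closure A `<=` closure ((fun x : V => `|x|) @^-1` [set r | r <= M1]).
  by apply: closureS => y; exact: AM.
by rewrite -((closure_id _).1 cl) => h /h.
Qed.

(** * Pointwise bounds from the maximum principle *)

Section laplacian_bounds.
Context {R : realType} {n : nat}.
Implicit Types (Om : set 'rV[R]_n) (u : 'rV[R]_n -> R) (x y : 'rV[R]_n).
Local Notation e_ i := (delta_mx 0 i : 'rV[R]_n).

Lemma laplacian_le Om u y (k : 'I_n -> R) : open Om -> Ck_on 2 Om u -> Om y ->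
  (forall i, \forall s \near (0 : R),
     u (y + s *: e_ i) + u (y - s *: e_ i) - 2 * u y <= k i * s ^+ 2) ->
  laplacian u y <= \sum_i k i.
Proof.
move=> oOm [_ /= uC] Omy uk; apply: ler_sum => i _.
have [du [_ ddu]] := uC i; apply: derive2_le (uk i).
  by apply: filterS (open_nbhs_nbhs (conj oOm Omy)); exact: du.
exact: (proj1 (ddu i) y Omy).
Qed.

Lemma laplacian_ge Om u y (k : 'I_n -> R) : open Om -> Ck_on 2 Om u -> Om y ->
  (forall i, \forall s \near (0 : R),
     k i * s ^+ 2 <= u (y + s *: e_ i) + u (y - s *: e_ i) - 2 * u y) ->
  \sum_i k i <= laplacian u y.
Proof.
move=> oOm [_ /= uC] Omy uk; apply: ler_sum => i _.
have [du [_ ddu]] := uC i; apply: derive2_ge (uk i).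
  by apply: filterS (open_nbhs_nbhs (conj oOm Omy)); exact: du.
exact: (proj1 (ddu i) y Omy).
Qed.

Definition sqnorm x : R := \sum_(i < n) x 0 i ^+ 2.

Lemma sqnorm_ge0 x : 0 <= sqnorm x.
Proof. by apply: sumr_ge0 => i _; exact: sqr_ge0. Qed.

Lemma sqnorm_line x s i :
  sqnorm (x + s *: e_ i) = sqnorm x + 2 * s * x 0 i + s ^+ 2.
Proof.
rewrite /sqnorm (bigD1 i)//= [in RHS](bigD1 i)//= !mxE !eqxx/= mulr1.
rewrite (eq_bigr (fun j => x 0 j ^+ 2)); first by ring.
by move=> j ji; rewrite !mxE eqxx (negbTE ji) mulr0 addr0.
Qed.

Lemma continuous_sqnorm : continuous (sqnorm : 'rV[R]_n -> R).
Proof.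
apply: continuous_big => [|i _]; first exact: add_continuous.
move=> x; have h := @coord_continuous R 1 n 0 i x.
exact: (cvg_comp _ _ h (@exprn_continuous R 2 (x 0 i))).
Qed.

Lemma near_line Om x (v : 'rV[R]_n) : open Om -> Om x ->
  \forall s \near (0 : R), Om (x + s *: v) /\ Om (x - s *: v).
Proof.
move=> oOm Omx.
have line w : (fun s : R => x + s *: w) @ (0 : R) --> x.
  rewrite -[X in _ --> X]addr0; apply: cvgD; first exact: cvg_cst.
  by rewrite -[X in _ --> X](scale0r w); apply: cvgZr_tmp; exact: cvg_id.
have H := line v _ (open_nbhs_nbhs (conj oOm Omx)).
have HN := line (- v) _ (open_nbhs_nbhs (conj oOm Omx)).
by near=> s; split; [near: s; exact: H|rewrite -scalerN; near: s; exact: HN].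
Unshelve. all: by end_near. Qed.

(** At a maximum of u + F |x|^2 inside Om the Laplacian of u would be at most -2 n F, below the
    allowed -F. The maximum is therefore on the boundary, where it is at most F D. Taking F as the
    coefficient, larger than the optimal F / (2 n), makes the contradiction strict. *)
Lemma laplacian_ge_upper_bound Om u (F D : R) : (0 < n)%N ->
  open Om -> bounded_set Om -> Ck_on 2 Om u -> {within closure Om, continuous u} ->
  0 < F -> (forall x, Om x -> - F <= laplacian u x) ->
  (forall x, closure Om x -> sqnorm x <= D) ->
  (forall x, (closure Om `\` Om) x -> u x <= 0) ->
  forall x, Om x -> u x <= F * D.
Proof.
move=> n_gt0 oOm bOm u2 u0 F_gt0 lapF QD ubd x Omx.
have cOm : compact (closure Om) by apply: bounded_closed_compact;
  [exact: bounded_closure|exact: closed_closure].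
pose z y := u y + F * sqnorm y.
have zc : {within closure Om, continuous z}.
  move=> y; apply: cvgD; first exact: u0.
  have : {within closure Om, continuous (fun y => F * sqnorm y)}; last exact.
  apply: continuous_subspaceT => w; apply: continuousM;
    [exact: cst_continuous|exact: continuous_sqnorm].
have [y yOm ymax] := EVT_max_rV (ex_intro _ _ (subset_closure Omx)) cOm zc.
rewrite inE in yOm.
have uz : u x <= z y.
  apply: le_trans (ymax x _); last by rewrite inE; exact: subset_closure.
  by rewrite /z lerDl mulr_ge0 ?sqnorm_ge0 ?ltW.
have [Omy|nOmy] := pselect (Om y); last first.
  apply: le_trans uz _; rewrite /z -[leRHS]add0r lerD//; first exact: ubd.
  by rewrite ler_pM2l//; exact: QD.
have : laplacian u y <= \sum_(i < n) (- 2 * F).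
  apply: (laplacian_le oOm u2 Omy) => i.
  have H := @near_line Om y (e_ i) oOm Omy; near=> s.
  have [Om1 Om2] : Om (y + s *: e_ i) /\ Om (y - s *: e_ i).
    by near: s; exact: H.
  have := ymax (y + s *: e_ i); have := ymax (y - s *: e_ i).
  rewrite !inE => /(_ (subset_closure Om2)) + /(_ (subset_closure Om1)).
  rewrite /z -scaleNr !sqnorm_line sqrrN; nra.
have := lapF y Omy.
rewrite sumr_const card_ord -mulr_natr => h1 h2.
have : (1 : R) <= n%:R by rewrite ler1n.
nra.
Unshelve. all: by end_near. Qed.

Definition paraboloid (x0 : 'rV[R]_n) (rho : R) x : R := rho ^+ 2 - sqnorm (x - x0).

Lemma paraboloid_line x0 rho x s i :
  paraboloid x0 rho (x + s *: e_ i) =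
  paraboloid x0 rho x - 2 * s * (x - x0) 0 i - s ^+ 2.
Proof. by rewrite /paraboloid addrAC sqnorm_line; ring. Qed.

Lemma continuous_paraboloid x0 rho x : {for x, continuous (paraboloid x0 rho)}.
Proof.
apply: (@cvgB _ _ _ (nbhs x)); first exact: cvg_cst.
have h : (y - x0) @[y --> x] --> x - x0 by apply: (@cvgB _ _ _ (nbhs x) _ id (cst x0));
  [exact: cvg_id|exact: cvg_cst].
exact: (cvg_comp _ _ h (@continuous_sqnorm _)).
Qed.

Lemma supersolution_lower_bound Om (p m : R) : (0 < n)%N ->
  open Om -> Om !=set0 -> 0 < p -> p < 1 -> 0 < m ->
  exists2 r : R, 0 < r & forall u, Ck_on 2 Om u -> (forall x, Om x -> 0 < u x) ->
    (forall x, Om x -> u x `^ p <= - m * laplacian u x) ->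
    exists2 x, Om x & r <= u x.
Proof.
move=> n_gt0 oOm [x0 Omx0] p0 p1 m0.
have /nbhs_rVP[e e0 eOm] := open_nbhs_nbhs (conj oOm Omx0).
(* The closed Euclidean ball of radius rho lies in the cube of half-side rho, and rho < e puts that
   cube inside Om. *)
pose rho := e / 2; have rho0 : 0 < rho by rewrite divr_gt0.
have rhoe : rho < e by rewrite /rho ltr_pdivrMr// mulr_natr mulr2n ltrDl.
pose w := paraboloid x0 rho.
have wOm x : 0 <= w x -> forall i, `|x0 0 i - x 0 i| <= rho.
  move=> wx i; rewrite -(@ler_pXn2r _ 2)// ?nnegrE ?(ltW rho0)//.
  rewrite real_normK ?num_real//.
  apply: le_trans (_ : sqnorm (x - x0) <= _); last by rewrite -subr_ge0.
  rewrite /sqnorm (bigD1 i)//= !mxE -[leLHS]sqrrN opprB lerDl.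
  by apply: sumr_ge0 => j _; exact: sqr_ge0.
have KOm x : 0 <= w x -> Om x.
  by move=> wx; apply: eOm => i; exact: le_lt_trans (wOm x wx i) rhoe.
pose K : set 'rV[R]_n := [set x | 0 <= w x].
have cK : compact K.
  apply: bounded_closed_compact.
    exists (`|x0| + rho); split; first exact: num_real.
    move=> M hM x /wOm xx0; apply: le_trans (ltW hM).
    rewrite -[x in leLHS](subrKC x0); apply: le_trans (ler_normD _ _) _.
    rewrite lerD2l [leLHS]/Num.Def.normr/= mx_normrE; apply/bigmax_leP.
    split; first exact: ltW.
    by move=> [i j] _/=; rewrite ord1 !mxE distrC; exact: xx0.
  have : closed (w @^-1` [set r | 0 <= r]); last exact.
  by apply: closed_comp; [move=> y _; exact: continuous_paraboloid|exact: closed_ge].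
(* The Laplacian of w^2 is 8 |x - x0|^2 - 4 n w = 8 rho^2 - (8 + 4 n) w. It vanishes at w = [w0],
   and [c] bounds its opposite because w <= rho^2. With mu the maximum of w^2 / u, [r0] is the
   solution X = 1 / mu of (w0^2)^p X^p = m c X, and rho^4 is the value of w^2 at x0. *)
pose c : R := (8 + 4 * n%:R) * rho ^+ 2.
have c0 : 0 < c by rewrite /c mulr_gt0 ?exprn_gt0// addr_gt0// mulr_gt0// ltr0n.
pose w0 : R := 8 * rho ^+ 2 / (8 + 4 * n%:R).
have n8 : 0 < 8 + 4 * n%:R :> R by rewrite addr_gt0// mulr_gt0// ltr0n.
have w00 : 0 < w0 by rewrite /w0 divr_gt0// mulr_gt0// exprn_gt0.
pose r0 : R := ((w0 ^+ 2) `^ p / (m * c)) `^ (1 - p)^-1.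
exists (rho ^+ 4 * r0).
  by rewrite mulr_gt0 ?exprn_gt0// /r0 powR_gt0// divr_gt0 ?mulr_gt0// powR_gt0// exprn_gt0.
move=> u u2 u0 lapu; exists x0 => //.
have wx0 : w x0 = rho ^+ 2 by rewrite /w /paraboloid subrr /sqnorm big1 ?subr0// => i _;
  rewrite mxE expr0n.
have Kx0 : K x0 by rewrite /K/= wx0 sqr_ge0.
pose g x := w x ^+ 2 / u x.
have gc : {within K, continuous g}.
  apply: continuous_in_subspaceT => x; rewrite inE => /KOm Omx.
  apply: (@cvgM _ _ (nbhs (x : 'rV[R]_n)) _ (fun y => w y ^+ 2) (fun y => (u y)^-1)).
    exact: (cvg_comp _ _ (@continuous_paraboloid x0 rho x) (@exprn_continuous R 2 (w x))).
  by apply: cvgV; [rewrite gt_eqF// u0|exact: (u2.1 x Omx)].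
have [y Ky ymax] := EVT_max_rV (ex_intro _ _ Kx0) cK gc.
rewrite inE in Ky.
have Omy := KOm _ Ky.
have uy0 := u0 _ Omy.
pose mu := g y.
have gx0 : rho ^+ 4 / u x0 <= mu.
  by have := ymax x0; rewrite inE => /(_ Kx0); rewrite {1}/g wx0 -exprM.
have mu0 : 0 < mu by apply: lt_le_trans gx0; rewrite divr_gt0 ?exprn_gt0 ?u0.
have wy0 : 0 < w y.
  rewrite lt_neqAle Ky andbT eq_sym; apply/eqP => wy.
  by move: mu0; rewrite /mu /g wy expr0n mul0r ltxx.
have wmu x : K x -> w x ^+ 2 <= mu * u x.
  move=> Kx; have := ymax x; rewrite inE => /(_ Kx).
  by rewrite {1}/g ler_pdivrMr// u0//; exact: KOm.
have wmuy : w y ^+ 2 = mu * u y by rewrite /mu /g divfK// gt_eqF.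
have oK : open (w @^-1` [set r | 0 < r]).
  by apply: open_comp; [move=> z _; exact: continuous_paraboloid|exact: open_gt].
(* The inequality w^2 <= mu u is an equality at y, so second differences of u dominate those of w^2
   / mu. For w^2 they equal (8 z^2 - 4 w) s^2 + 2 s^4, and the quartic term has the favourable
   sign. *)
have : \sum_(i < n) (mu^-1 * (8 * (y - x0) 0 i ^+ 2 - 4 * w y)) <= laplacian u y.
  apply: (laplacian_ge oOm u2 Omy) => i.
  have H := @near_line _ y (e_ i) oK wy0; near=> s.
  have [/= w1 w2] : (w @^-1` [set r | 0 < r]) (y + s *: e_ i) /\ (w @^-1` [set r | 0 < r])
    (y - s *: e_ i).
    by near: s; exact: H.
  have := wmu _ (ltW w1); have := wmu _ (ltW w2).
  rewrite /w -scaleNr !paraboloid_line -/w => h1 h2.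
  rewrite -mulrA ler_pdivrMl//.
  move: h1 h2 wmuy; set z := (y - x0) 0 i; set a := w y; set A := u _; set B := u _;
    set D := u y.
  move=> h1 h2 h3; have := sqr_ge0 (s ^+ 2); nra.
rewrite -mulr_sumr sumrB -mulr_sumr sumr_const card_ord -[\sum_(i < n) _]/(sqnorm (y - x0)).
have -> : sqnorm (y - x0) = rho ^+ 2 - w y by rewrite /w /paraboloid; ring.
rewrite ler_pdivrMl// -mulr_natr => lapy.
have up0 : 0 < u y `^ p by rewrite powR_gt0.
have key : u y `^ p <= m * mu^-1 * ((8 + 4 * n%:R) * w y - 8 * rho ^+ 2).
  apply: le_trans (lapu _ Omy) _; rewrite mulNr -mulrN -mulrA ler_pM2l//.
  rewrite ler_pdivlMl//; lra.
(* The left side of [key] is strictly positive, hence so is the bracket on the right. *)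
have w0y : w0 < w y.
  have mm : 0 < m * mu^-1 by rewrite mulr_gt0// invr_gt0.
  rewrite /w0 ltr_pdivrMr// [w y * _]mulrC -subr_gt0 -(pmulr_rgt0 _ mm).
  exact: (lt_le_trans up0 key).
have wle : w y <= rho ^+ 2 by rewrite /w /paraboloid gerBl sqnorm_ge0.
have key2 : u y `^ p <= m * mu^-1 * c.
  apply: le_trans key _; rewrite ler_pM2l ?mulr_gt0 ?invr_gt0// /c.
  rewrite lerBlDr; apply: (@le_trans _ _ ((8 + 4 * n%:R) * rho ^+ 2)).
    by rewrite ler_pM2l.
  by rewrite lerDl mulr_ge0// sqr_ge0.
have uy : (w0 ^+ 2) * mu^-1 <= u y.
  rewrite ler_pdivrMr// mulrC -wmuy ler_pXn2r// ?nnegrE; exact: ltW.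
have key3 : (w0 ^+ 2) `^ p * mu^-1 `^ p <= m * mu^-1 * c.
  apply: le_trans key2; rewrite -powRM; [|exact: sqr_ge0|by rewrite invr_ge0 ltW].
  have mu1 : 0 <= w0 ^+ 2 * mu^-1 by rewrite mulr_ge0 ?sqr_ge0// invr_ge0 ltW.
  by apply: ge0_ler_powR => //; rewrite ?nnegrE// ltW.
(* Dividing [key3] by the p-th power of 1 / mu leaves the power 1 - p > 0, which can be inverted
   monotonically. *)
have r0mu : r0 <= mu^-1.
  have p1' : 0 < 1 - p by rewrite subr_gt0.
  rewrite -[leRHS]powRr1 ?invr_ge0 ?(ltW mu0)// -[in leRHS](mulfV (lt0r_neq0 p1')) powRrM.
  apply: ge0_ler_powR.
  - by rewrite invr_ge0 ltW.
  - by rewrite nnegrE divr_ge0 ?powR_ge0// ltW// mulr_gt0.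
  - by rewrite nnegrE powR_ge0.
  rewrite ler_pdivrMr ?mulr_gt0//.
  have mup : 0 < mu^-1 `^ p by rewrite powR_gt0// invr_gt0.
  rewrite -(ler_pM2r mup); apply: le_trans key3 _.
  rewrite [leRHS]mulrAC -powRD; last by rewrite implybE subrK oner_eq0.
  rewrite subrK powRr1 ?invr_ge0 ?(ltW mu0)//.
  by rewrite [leRHS]mulrA [mu^-1 * m]mulrC.
rewrite ler_pdivrMr ?u0// in gx0.
apply: le_trans (_ : rho ^+ 4 * mu^-1 <= _).
  by rewrite ler_pM2l ?exprn_gt0.
by rewrite ler_pdivrMr// mulrC.
Unshelve. all: by end_near. Qed.

End laplacian_bounds.

(** * Integration over R^n along coordinate lines *)

Section with_sigma_finite.
Context d (T : measurableType d) (R : realType).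
Context (m : {measure set T -> \bar R}) (m_sf : sigma_finite setT m).

(* A copy of m on which sigma-finiteness is canonical, as Fubini requires. *)
Definition with_sigma_finite of sigma_finite setT m : set T -> \bar R := m.

HB.instance Definition _ := Measure.copy (with_sigma_finite m_sf) m.

HB.instance Definition _ :=
  Measure_isSigmaFinite.Build _ _ _ (with_sigma_finite m_sf) m_sf.

End with_sigma_finite.

Section tuple_measure.
Context {R : realType}.
Local Notation mR := (measurableTypeR R).

Definition box (L : R) (n : nat) : set (n.-tuple mR) :=
  [set s | forall i, `|tnth s i| <= L].
Arguments box L {n}.

Lemma measurable_box L n : measurable (@box L n).
Proof.
rewrite (_ : @box L n = \bigcap_(i in [set: 'I_n])
    ((fun s => tnth s i) @^-1` [set x : mR | `|x| <= L])); last first.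
  by apply/seteqP; split=> s /= h i; [move=> _|]; exact: h.
apply: fin_bigcap_measurable => // i _; rewrite -[X in measurable X]setTI.
apply: measurable_tnth => //.
rewrite (_ : [set _ | _] = `[- L, L]%classic); first exact: measurable_itv.
by apply/seteqP; split=> x /=; rewrite in_itv/= ler_norml.
Qed.

Lemma cons_pair_box L n :
  @cons_pair R n @^-1` (box L) = box L `*` `[- L, L].
Proof.
apply/seteqP; split=> -[s x] /=.
  move=> h; split => /=.
    by move=> i; have := h (lift ord0 i); rewrite /cons_pair tnthS.
  by have := h ord0; rewrite /cons_pair tnth0 in_itv/= ler_norml.
move=> [h1 h2] i; rewrite /cons_pair; case: (unliftP ord0 i) => [j|] ->.
  by rewrite tnthS; exact: h1.
by rewrite tnth0 ler_norml; move: h2; rewrite in_itv.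
Qed.

Lemma lebesgue_tuple_box L n : (lebesgue_tuple n (@box L n) < +oo)%E.
Proof.
elim: n => [|n IH].
  by rewrite /= diracE; case: (_ \in _) => //=; rewrite ?ltry.
rewrite /= /pushforward cons_pair_box product_measure1E; last 2 first.
- exact: measurable_box.
- exact: measurable_itv.
have itv_fin : ((@lebesgue_measure R `[(- L)%R, L%R]%classic < +oo)%E).
  by rewrite lebesgue_measure_itv/=; case: ifP => // _; exact: ltry.
by rewrite lte_mul_pinfty// ge0_fin_numE.
Qed.

Lemma sigma_finite_lebesgue_tuple n :
  sigma_finite setT (@lebesgue_tuple R n).
Proof.
exists (fun k => box k%:R).
  apply/seteqP; split=> // s _.
  have [k hk] : exists k : nat, \sum_(i < n) `|tnth s i| <= k%:R.
    exists (Num.bound (\sum_(i < n) `|tnth s i|)).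
    by apply/ltW/archi_boundP/sumr_ge0.
  exists k => // i; apply: le_trans hk.
  by rewrite (bigD1 i)//= lerDl sumr_ge0.
move=> k; split; [exact: measurable_box|exact: lebesgue_tuple_box].
Qed.

(** As x varies this traces the coordinate line through s in direction i. *)
Definition tset n (s : n.-tuple mR) (i : 'I_n) (x : R) : n.-tuple mR :=
  [tuple (if j == i then x else tnth s j) | j < n].

Lemma tset_cons0 n (s : n.-tuple mR) y x :
  tset (cons_pair (s, y)) ord0 x = cons_pair (s, x).
Proof.
apply: eq_from_tnth => j; rewrite tnth_mktuple /cons_pair.
case: (unliftP ord0 j) => [k|] ->; last by rewrite eqxx tnth0.
by rewrite -(inj_eq val_inj)/= !tnthS.
Qed.

Lemma tset_consS n (s : n.-tuple mR) y i x :
  tset (cons_pair (s, y)) (lift ord0 i) x = cons_pair (tset s i x, y).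
Proof.
apply: eq_from_tnth => j; rewrite tnth_mktuple /cons_pair.
case: (unliftP ord0 j) => [k|] ->; last by rewrite -(inj_eq val_inj)/= !tnth0.
by rewrite (inj_eq lift_inj) !tnthS tnth_mktuple.
Qed.

Lemma bounded_support_integrable d (T : measurableType d)
    (mu : {measure set T -> \bar R}) (A : set T) (f : T -> R) M :
  measurable A -> (mu A < +oo)%E ->
  measurable_fun setT f -> (forall s, `|f s| <= M) ->
  (forall s, ~ A s -> f s = 0) ->
  mu.-integrable setT (EFin \o f).
Proof.
move=> mA muA mf fM f0.
have : mu.-integrable A (EFin \o f).
  apply: measurable_bounded_integrable => //.
  - exact: measurable_funTS.
  - by exists M; split; rewrite ?num_real// => x Mx y _; exact: le_trans (fM y) (ltW Mx).
move/(integrable_mkcond _ mA).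
congr integrable; apply/funext => s; rewrite patchE.
by case: ifPn => //; rewrite notin_setE => /f0/= ->.
Qed.

(* By Fubini, integrate the head coordinate first if it is the i-th one, and
   otherwise freeze it and use induction. *)
Lemma integral_lines0 n (i : 'I_n) (f : n.-tuple mR -> R) L M :
  measurable_fun setT f -> (forall s, `|f s| <= M) ->
  (forall s, ~ box L s -> f s = 0) ->
  (forall s, (\int[@lebesgue_measure R]_x (f (tset s i x))%:E = 0)%E) ->
  (\int[lebesgue_tuple n]_s (f s)%:E = 0)%E.
Proof.
elim: n => [|n IH] in i f *; first by case: i.
move=> mf fM f0 fi.
have mfc : measurable_fun setT (f \o @cons_pair R n).
  by apply: measurableT_comp => //; exact: measurable_cons_pair.
have fint : (lebesgue_tuple n \x @lebesgue_measure R)%E.-integrable setT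
    (EFin \o (f \o @cons_pair R n)).
  apply: (@bounded_support_integrable
    _ _ (lebesgue_tuple n \x @lebesgue_measure R)%E (box L `*` `[- L, L])
    (f \o @cons_pair R n) M).
  - by apply: measurableX; [exact: measurable_box|exact: measurable_itv].
  - have := lebesgue_tuple_box L n.+1; rewrite /= /pushforward cons_pair_box.
    exact.
  - exact: mfc.
  - by move=> s; exact: fM.
  - by move=> s hs; apply: f0 => h; apply: hs; rewrite -cons_pair_box.
rewrite /= integral_pushforward//=; last 2 first.
- exact: measurable_cons_pair.
- by apply/measurable_EFinP.
rewrite preimage_setT.
pose mu := with_sigma_finite (sigma_finite_lebesgue_tuple n).
case: (unliftP ord0 i) => [j|] ij; last first.
  rewrite -(integral12_prod_meas1 (m1 := mu) fint).
  rewrite /fubini_F/= (eq_integral (fun=> 0%E)) ?integral0// => s _.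
  (* The head value 0 is a dummy, overwritten by [tset]. *)
  under eq_integral do rewrite -(tset_cons0 s 0).
  by rewrite -ij; exact: fi.
rewrite -(integral21_prod_meas1 (m1 := mu) fint).
rewrite /fubini_G/= (eq_integral (fun=> 0%E)) ?integral0// => x _.
apply: (IH j (fun s => f (cons_pair (s, x)))).
- apply: (measurableT_comp mf); apply: (@measurable_cons _ _ _ _ (fun=> x) _ id);
  [exact: measurable_cst|exact: measurable_id].
- by move=> s; exact: fM.
- move=> s hs; apply: f0 => h; apply: hs.
  have : (@cons_pair R n @^-1` (box L)) (s, x) by [].
  by rewrite cons_pair_box => -[].
- by move=> s; under eq_integral do rewrite -tset_consS -ij; exact: fi.
Qed.

End tuple_measure.

(** * Measurability of continuous functions on R^n *)

Section measurable_continuous.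
Context {R : realType} {n : nat}.
Local Notation mR := (measurableTypeR R).

(** The topology lives on row vectors and the product sigma-algebra on tuples. They are linked by
    writing A as a countable union of cubes with rational centres and half-sides 1 / (k + 1); each
    cube is a finite intersection of conditions on single coordinates. *)
Lemma measurable_open_rV (A : set 'rV[R]_n) :
  open A -> measurable (@rV_of_tuple R n @^-1` A).
Proof.
move=> oA.
pose cube (q : 'rV[rat]_n * nat) : set 'rV[R]_n :=
  [set y | forall i, `|ratr (q.1 0 i) - y 0 i| < q.2.+1%:R^-1].
have -> : @rV_of_tuple R n @^-1` A = \bigcup_q
    (if `[< cube q `<=` A >] then @rV_of_tuple R n @^-1` cube q else set0).
  apply/seteqP; split=> [s As|s [q _]]; last by case: asboolP => // + ?; exact.
  set x := rV_of_tuple s; have [e e0 xA] := (nbhs_rVP x A).1 (open_nbhs_nbhs (conj oA As)).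
  (* Half of e for the distance from the rational centre to x, half for the distance from the centre
     to any other point of the cube. *)
  have e20 : 0 < e / 2 by rewrite divr_gt0.
  have [k hk] : exists k : nat, k.+1%:R^-1 < e / 2.
    have [k _ hk] := near_infty_natSinv_lt (PosNum e20).
    by exists k; apply: (hk k) => /=.
  have /choice[q hq] : forall i, exists q : rat, `|ratr q - x 0 i| < k.+1%:R^-1.
    move=> i; have [|q] := @rat_in_itvoo R (x 0 i - k.+1%:R^-1) (x 0 i + k.+1%:R^-1).
      by rewrite ltrBlDr -addrA ltrDl addr_gt0// invr_gt0.
    rewrite in_itv/= => /andP[q1 q2]; exists q.
    by rewrite ltr_norml ltrBlDr ltrBrDr ![_ + x 0 i]addrC q1.
  exists (\row_i q i, k) => //.
  case: asboolP => [_|[]]; first by move=> i; rewrite /= mxE; exact: hq.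
  move=> y yq; apply: xA => i; have := yq i; rewrite /= mxE => yqi.
  rewrite (_ : _ - _ = (ratr (q i) - y 0 i) - (ratr (q i) - x 0 i)); last by ring.
  apply: le_lt_trans (ler_normB _ _) _; rewrite [ltRHS]splitr; apply: ltrD;
    [exact: lt_trans yqi hk|exact: lt_trans (hq i) hk].
apply: countable_bigcupT_measurable; first exact: countableP.
move=> q; case: asboolP => // _.
rewrite (_ : _ @^-1` _ = \bigcap_(i in [set: 'I_n]) ((fun s => tnth s i) @^-1`
    [set x : mR | `|ratr (q.1 0 i) - x| < q.2.+1%:R^-1])); last first.
  apply/seteqP; split=> s /= h i; first by move=> _; have := h i; rewrite mxE.
  by rewrite mxE; exact: h.
apply: fin_bigcap_measurable => // i _; rewrite -[X in measurable X]setTI.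
apply: measurable_tnth => //.
set c := ratr _; set e := _^-1.
rewrite (_ : [set _ | _] = `]c - e, c + e[%classic); first exact: measurable_itv.
apply/seteqP; split=> x /=; rewrite in_itv/= ltr_norml.
  by move=> /andP[h1 h2]; apply/andP; split; lra.
by move=> /andP[h1 h2]; apply/andP; split; lra.
Qed.

Lemma measurable_continuous_rV (A : set 'rV[R]_n) (f : 'rV[R]_n -> R) :
  open A -> (forall x, A x -> {for x, continuous f}) ->
  measurable_fun (@rV_of_tuple R n @^-1` A) (fun s => f (rV_of_tuple s)).
Proof.
move=> oA cf; apply: (measurability _ (RGenOpens.measurableE R)).
move=> _ [_ [a [b ->] <-]].
apply: (measurable_open_rV (A := A `&` f @^-1` `]a, b[)).
rewrite openE => x [Ax fx]; apply: filterI; first exact: open_nbhs_nbhs.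
by apply: (cf x Ax); apply: open_nbhs_nbhs; split; [exact: interval_open|].
Qed.

Lemma measurable_continuous_indic (A : set 'rV[R]_n) (f : 'rV[R]_n -> R) :
  open A -> (forall x, A x -> {for x, continuous f}) ->
  measurable_fun [set: n.-tuple mR]
    (fun s => f (rV_of_tuple s) * \1_A (rV_of_tuple s)).
Proof.
move=> oA cf.
have := (measurable_restrictT (fun s => f (rV_of_tuple s)) (measurable_open_rV oA)).1
  (measurable_continuous_rV oA cf).
congr measurable_fun; apply/funext => s; rewrite patchE indicE.
rewrite (_ : (rV_of_tuple s \in A) = (s \in @rV_of_tuple R n @^-1` A)); last first.
  by apply/idP/idP; rewrite !inE.
by case: (_ \in _); rewrite ?mulr1 ?mulr0.
Qed.

End measurable_continuous.

(** * The truncation of u and its derivative *)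

Section truncation.
Context {R : realType}.
Implicit Types (s e : R).

Definition pospart s : R := Num.max s 0.

Lemma pospart_ge0 s : 0 <= pospart s.
Proof. by rewrite /pospart le_max lexx orbT. Qed.

Lemma continuous_pospart : continuous pospart.
Proof.
move=> s; have -> : pospart = (fun s : R => (s + `|s|) / 2).
  apply/funext => t; rewrite /pospart; case: (leP 0 t) => [t0|t0].
    by rewrite ger0_norm//; field.
  by rewrite ltr0_norm//; field.
apply: (@cvgMr_tmp _ _ (nbhs s)); apply: cvgD; [exact: cvg_id|exact: norm_continuous].
Qed.

Lemma is_derive_pospart2 s :
  is_derive s (1 : R) (fun t : R => pospart t ^+ 2) (2 * pospart s).
Proof.
have [s0|s0|<-] := ltgtP 0 s.
- apply: (near_eq_is_derive (f := (id ^+ 2 : R -> R))).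
    near=> t; rewrite /pospart max_l//; apply: ltW; near: t; exact: lt_nbhsr.
  by apply: is_derive_eq; rewrite /pospart max_l ?ltW// /GRing.scale/=; ring.
- apply: (near_eq_is_derive (f := cst 0)).
    near=> t; rewrite /pospart max_r ?expr0n//; apply: ltW; near: t; exact: lt_nbhsl.
  by apply: is_derive_eq; rewrite /pospart max_r ?ltW// mulr0.
have pos0 : pospart 0 = 0 by rewrite /pospart maxxx.
(* At the corner the difference quotient is [pospart h] itself, which tends to 0. *)
have h : (fun h : R =>
    h^-1 *: (pospart (h *: (1 : R) + 0) ^+ 2 - pospart 0 ^+ 2)) @ (0 : R)^'
    --> (0 : R).
  have : pospart h @[h --> (0 : R)^'] --> (0 : R).
    by rewrite -[X in _ --> X]pos0; apply: cvg_within_filter; exact: continuous_pospart.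
  apply: cvg_trans; apply: near_eq_cvg; near=> h.
  have h0 : h != 0 by near: h; exact: nbhs_dnbhs_neq.
  rewrite [h *: 1]mulr1 addr0 pos0 expr0n subr0 /pospart.
  case: (leP 0 h) => hh; last by rewrite expr0n scaler0.
  by rewrite /GRing.scale/= expr2 mulKf.
rewrite pos0 mulr0; apply: DeriveDef.
  by apply/cvg_ex; exists 0.
exact: cvg_lim h.
Unshelve. all: by end_near. Qed.

(* cutoff e increases to the identity as e decreases to 0, and it is C^1 because
   the positive part is squared. *)
Definition cutoff e s : R := pospart (s - e) ^+ 2 / s.

(** The derivative of [cutoff e] for s > 0, written through P = [pospart (s - e)] as P (2 s - P) /
    s^2, so that its sign and its monotonicity in e follow from 0 <= P <= s. *)
Definition cutoff1 e s : R := pospart (s - e) * (2 * s - pospart (s - e)) / s ^+ 2.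

Lemma is_derive_cutoff e s : 0 < s -> is_derive s (1 : R) (cutoff e) (cutoff1 e s).
Proof.
move=> s0.
have d1 : is_derive s (1 : R) (fun t : R => pospart (t - e) ^+ 2) (2 * pospart (s - e)).
  have dsub : is_derive s (1 : R) (fun t : R => t - e) 1.
    by apply: is_derive_eq; rewrite subr0.
  have := @is_derive1_comp R (fun t => pospart t ^+ 2) (fun t =>
    t - e) s _ _ (is_derive_pospart2 (s - e)) dsub.
  by rewrite mulr1.
have d2 : is_derive s (1 : R) (fun t : R => t^-1) (- s ^- 2).
  have := is_deriveV (f := id) (lt0r_neq0 s0) (is_derive_id s (1 : R)).
  by rewrite [_ *: 1]mulr1.
have d3 := @is_deriveM _ _ _ _ _ _ _ _ d1 d2; apply: (@is_derive_eq _ _ _ _ _ _ _ _ d3).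
rewrite /cutoff1 /GRing.scale/=; field; exact: lt0r_neq0.
Qed.

Lemma continuous_cutoff1 e s : 0 < s -> {for s, continuous (cutoff1 e)}.
Proof.
move=> s0.
have cp : pospart (t - e) @[t --> s] --> pospart (s - e).
  have h : (t - e) @[t --> s] --> s - e by apply: cvgB; [exact: cvg_id|exact: cvg_cst].
  exact: (cvg_comp _ _ h (@continuous_pospart _)).
apply: (@cvgM _ _ (nbhs s) _ (fun t =>
  pospart (t - e) * (2 * t - pospart (t - e))) (fun t => (t ^+ 2)^-1)).
  apply: cvgM => //; apply: cvgB => //.
  by apply: cvgMl_tmp; exact: cvg_id.
apply: cvgV; first by rewrite expf_neq0// lt0r_neq0.
exact: exprn_continuous.
Qed.

Lemma pospart_sub_le e s : 0 <= e -> 0 <= s -> pospart (s - e) <= s.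
Proof. by move=> e0 s0; rewrite /pospart ge_max s0 gerBl e0. Qed.

Lemma cutoff_ge0 e s : 0 <= s -> 0 <= cutoff e s.
Proof. by move=> s0; rewrite /cutoff divr_ge0// sqr_ge0. Qed.

Lemma cutoff_le e s : 0 <= e -> 0 < s -> cutoff e s <= s.
Proof.
move=> e0 s0; rewrite /cutoff ler_pdivrMr// -expr2.
by rewrite ler_pXn2r ?nnegrE ?pospart_ge0 ?(ltW s0)// pospart_sub_le// ltW.
Qed.

Lemma cutoff_eq0 e s : s <= e -> cutoff e s = 0.
Proof. by move=> se; rewrite /cutoff /pospart max_r ?subr_le0// expr0n mul0r. Qed.

Lemma cutoff1_eq0 e s : s <= e -> cutoff1 e s = 0.
Proof. by move=> se; rewrite /cutoff1 /pospart max_r ?subr_le0// !mul0r. Qed.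

Lemma cutoff1_ge0 e s : 0 <= e -> 0 < s -> 0 <= cutoff1 e s.
Proof.
move=> e0 s0; rewrite /cutoff1 divr_ge0 ?sqr_ge0// mulr_ge0 ?pospart_ge0//.
by have := pospart_sub_le e0 (ltW s0); lra.
Qed.

(** The map P -> P (2 s - P) increases on [0, s], and [pospart (s - e)] stays in this interval and
    decreases in e. This supplies the monotonicity for monotone convergence. *)
Lemma cutoff1_le e e' s :
  0 <= e' -> e' <= e -> 0 < s -> cutoff1 e s <= cutoff1 e' s.
Proof.
move=> e0 ee s0; rewrite /cutoff1 ler_pM2r ?invr_gt0 ?exprn_gt0//.
have h1 := pospart_sub_le e0 (ltW s0).
have h2 : pospart (s - e) <= pospart (s - e')
  by rewrite /pospart ge_max !le_max lerD2l lerN2 ee lexx orbT.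
have := pospart_ge0 (s - e).
nra.
Qed.

Lemma cvg_cutoff1 s : 0 < s -> cutoff1 n.+1%:R^-1 s @[n --> \oo] --> (1 : R).
Proof.
move=> s0.
have cp : pospart (s - n.+1%:R^-1) @[n --> \oo] --> s.
  have h : (s - (n.+1%:R^-1 : R)) @[n --> \oo] --> s.
    by rewrite -[X in _ --> X]subr0; apply: cvgB; [exact: cvg_cst|exact: cvg_harmonic].
  have := cvg_comp _ _ h (@continuous_pospart s).
  by rewrite {2}/pospart max_l ?ltW.
rewrite [X in _ --> X](_ : 1 = s * (2 * s - s) / s ^+ 2); last first.
  by field; exact: lt0r_neq0.
have c2 : 2 * s - pospart (s - n.+1%:R^-1) @[n --> \oo] --> 2 * s - s.
  by apply: cvgB cp; exact: cvg_cst.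
by apply: cvgMr_tmp; apply: cvgM.
Qed.

End truncation.

(** * Partial derivatives of compactly supported functions have integral zero *)

Section divergence.
Context {R : realType} {n : nat}.
Local Notation mR := (measurableTypeR R).
Local Notation e_ i := (delta_mx 0 i : 'rV[R]_n).
Implicit Types (x : 'rV[R]_n).

Lemma rV_of_tuple_tset (s : n.-tuple mR) i t :
  rV_of_tuple (tset s i t) = rV_of_tuple (tset s i 0) + t *: e_ i.
Proof.
apply/rowP => j; rewrite !mxE !tnth_mktuple eqxx/=.
by case: (eqVneq j i) => _; rewrite ?mulr1 ?mulr0 ?add0r ?addr0.
Qed.

(** The fundamental theorem of calculus evaluates G at the endpoints, so G must vanish there too; g
    has to vanish only beyond them. *)
Lemma integral_line_derivative (G g : R -> R) (L : R) : 0 < L ->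
  continuous g -> (forall t, is_derive (t : R) (1 : R) G (g t)) ->
  (forall t, L <= `|t| -> G t = 0) -> (forall t, L < `|t| -> g t = 0) ->
  (\int[@lebesgue_measure R]_t (g t)%:E = 0)%E.
Proof.
move=> L0 gc dG G0 g0.
have -> : (\int[@lebesgue_measure R]_t (g t)%:E =
    \int[@lebesgue_measure R]_(t in `[(- L)%R, L]) (g t)%:E)%E.
  rewrite [RHS]integral_mkcond; apply: eq_integral => t _; rewrite patchE.
  case: ifPn => //; rewrite notin_setE/= in_itv/= -ler_norml => /negP.
  by rewrite -ltNge => /g0 ->.
have cG : continuous G.
  by move=> t; apply: differentiable_continuous; apply/derivable1_diffP; case: (dG t).
have LL : - L < L by rewrite (lt_trans _ L0)// oppr_lt0.
have gc' : {within `[- L, L], continuous g} by exact: continuous_subspaceT.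
have dG' : derivable_oo_LRcontinuous G (- L) L.
  split=> [t _||]; first by case: (dG t).
    by apply: cvg_at_right_filter; exact: cG.
  by apply: cvg_at_left_filter; exact: cG.
have G'g : {in `](- L), L[, derive1 G =1 g}.
  by move=> t _; rewrite derive1E; case: (dG t).
rewrite (continuous_FTC2 LL gc' dG' G'g).
by rewrite !G0 ?subee// ?normrN gtr0_norm.
Qed.

Lemma integral_compact_partial (i : 'I_n) (V f : 'rV[R]_n -> R) (L M : R) :
  (forall x, {for x, continuous f}) ->
  (forall x, is_derive x (e_ i) V (f x)) ->
  (forall x j, L < `|x 0 j| -> V x = 0 /\ f x = 0) ->
  (forall x, `|f x| <= M) ->
  (lebesgue_tuple n).-integrable setT (fun s => (f (rV_of_tuple s))%:E) /\
  (\int[lebesgue_tuple n]_s (f (rV_of_tuple s))%:E = 0)%E.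
Proof.
move=> fc dV out fM.
have mf : measurable_fun setT (fun s : n.-tuple mR => f (rV_of_tuple s)).
  have := @measurable_continuous_rV R n setT f openT (fun x _ => fc x).
  by rewrite preimage_setT.
have f0 (s : n.-tuple mR) : ~ box L s -> f (rV_of_tuple s) = 0.
  move=> /existsNP[j /negP]; rewrite -ltNge => Lj.
  by have [] := out (rV_of_tuple s) j; rewrite ?mxE.
split.
  exact: (bounded_support_integrable (@measurable_box R L n) (@lebesgue_tuple_box R L n)
    mf (fun s => fM (rV_of_tuple s)) f0).
apply: (integral_lines0 (i := i) mf (fun s => fM (rV_of_tuple s)) f0) => s.
set a := rV_of_tuple (tset s i 0).
under eq_integral do rewrite rV_of_tuple_tset -/a.
have ai t : (a + t *: e_ i) 0 i = t.
  by rewrite /a !mxE tnth_mktuple !eqxx add0r mulr1.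
(* The endpoints must lie strictly beyond L, and L may be negative, hence [|L| + 1]. *)
apply: (@integral_line_derivative (fun t => V (a + t *: e_ i)) _ (`|L| + 1)).
- by rewrite ltr_wpDl.
- move=> t; have h : (a + r *: e_ i) @[r --> t] --> a + t *: e_ i.
    by apply: cvgD; [exact: cvg_cst|apply: cvgZr_tmp; exact: cvg_id].
  exact: (cvg_comp _ _ h (fc _)).
- move=> t; have [dv <-] := dV (a + t *: e_ i); exact: is_derive_line.
- move=> t Lt; have [] // := out (a + t *: e_ i) i; rewrite ai.
  by apply: lt_le_trans Lt; rewrite (le_lt_trans (ler_norm _))// ltrDl.
- move=> t Lt; have [] // := out (a + t *: e_ i) i; rewrite ai.
  by apply: lt_trans Lt; rewrite (le_lt_trans (ler_norm _))// ltrDl.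
Qed.

End divergence.

(** * Extension by zero, and the chain rule along lines *)

Section extension_by_zero.
Context {R : realType} {n : nat}.
Implicit Types (Om : set 'rV[R]_n) (f : 'rV[R]_n -> R) (x : 'rV[R]_n).

Definition ext0 Om f x : R := f x * \1_Om x.

Lemma ext0_in Om f x : Om x -> ext0 Om f x = f x.
Proof. by move=> Omx; rewrite /ext0 indicE mem_set// mulr1. Qed.

Lemma ext0_out Om f x : ~ Om x -> ext0 Om f x = 0.
Proof. by move=> Omx; rewrite /ext0 indicE memNset// mulr0. Qed.

Lemma near_ext0_in Om f x : open Om -> Om x -> \forall y \near x, f y = ext0 Om f y.
Proof.
move=> oOm Omx; near=> y; rewrite ext0_in//; near: y.
exact: open_nbhs_nbhs.
Unshelve. all: by end_near. Qed.

Lemma near_ext0_out Om f x : (\forall y \near x, Om y -> f y = 0) ->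
  \forall y \near x, 0 = ext0 Om f y.
Proof.
apply: filterS => y fy; have [Omy|nOmy] := pselect (Om y).
  by rewrite ext0_in// fy.
by rewrite ext0_out.
Qed.

(** Near a point outside Om, boundary points included, the extension is identically 0; near a point
    of the open set Om it coincides with f. *)
Lemma continuous_ext0 Om f : open Om ->
  (forall x, Om x -> {for x, continuous f}) ->
  (forall x, ~ Om x -> \forall y \near x, Om y -> f y = 0) ->
  forall x, {for x, continuous (ext0 Om f)}.
Proof.
move=> oOm fc fz x; have [Omx|nOmx] := pselect (Om x).
  have : ext0 Om f y @[y --> x] --> ext0 Om f x; last exact.
  rewrite (ext0_in _ Omx).
  exact: (cvg_trans (near_eq_cvg (near_ext0_in f oOm Omx)) (fc x Omx)).
have : ext0 Om f y @[y --> x] --> ext0 Om f x; last exact.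
rewrite (ext0_out _ nOmx).
apply: (cvg_trans (near_eq_cvg (near_ext0_out (fz x nOmx)))).
exact: cvg_cst.
Qed.

Lemma is_derive_ext0 Om f g x v : open Om ->
  (Om x -> is_derive x v f (g x)) ->
  (~ Om x -> \forall y \near x, Om y -> f y = 0) ->
  is_derive x v (ext0 Om f) (ext0 Om g x).
Proof.
move=> oOm fg fz; have [Omx|nOmx] := pselect (Om x).
  rewrite (ext0_in _ Omx).
  exact: (near_eq_is_derive (near_ext0_in f oOm Omx) (fg Omx)).
rewrite (ext0_out _ nOmx).
exact: (near_eq_is_derive (near_ext0_out (fz nOmx))).
Qed.

End extension_by_zero.

Lemma is_derive_of_line {R : realType} {V : normedModType R} (f : V -> R) (x v : V)
  (d : R) :
  is_derive (0 : R) (1 : R) (fun t : R => f (x + t *: v)) d -> is_derive x v f d.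
Proof.
have E : (fun h : R => h^-1 *: (f (x + (h *: (1 : R) + 0) *: v) - f (x + 0 *: v))) =
    (fun h : R => h^-1 *: (f (h *: v + x) - f x)).
  apply/funext => h; rewrite scale0r !addr0; congr (_ *: (f _ - _)).
  by rewrite [_ *: 1]mulr1 addrC.
by move=> [df dE]; split; move: df dE; rewrite /derivable /derive/= E.
Qed.

(** Restricting to the line through x reduces this to the one-variable chain rule, so a directional
    derivative of f at x suffices in place of a full differential. *)
Lemma is_derive_comp_line {R : realType} {V : normedModType R} (H : R -> R) (f : V -> R)
    (x v : V) (c d : R) :
  is_derive (f x) (1 : R) H c -> is_derive x v f d ->
  is_derive x v (fun y => H (f y)) (c * d).
Proof.
move=> dH [df dE]; apply: is_derive_of_line.
have dl : is_derive (0 : R) (1 : R) (fun t : R => f (x + t *: v)) d.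
  by have := @is_derive_line R V f x v 0; rewrite scale0r addr0 dE; exact.
have dH' : is_derive (f (x + 0 *: v)) (1 : R) H c by rewrite scale0r addr0.
exact: (@is_derive1_comp R H (fun t : R => f (x + t *: v)) 0 _ _ dH' dl).
Qed.

(** * The energy estimate *)

Section energy.
Context {R : realType} {n : nat} (Om : set 'rV[R]_n) (u : 'rV[R]_n -> R) (S F L : R).
Context (oOm : open Om) (u2 : Ck_on 2 Om u) (u0 : {within closure Om, continuous u}).
Context (u_bd : forall x, (closure Om `\` Om) x -> u x = 0).
Context (u_gt0 : forall x, Om x -> 0 < u x) (u_le : forall x, Om x -> u x <= S).
Context (S_ge0 : 0 <= S) (F_ge0 : 0 <= F) (lap_ge : forall x, Om x -> - F <= laplacian u x).
Context (Om_box : forall x i, Om x -> `|x 0 i| <= L).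
Local Notation e_ i := (delta_mx 0 i : 'rV[R]_n).
Implicit Types (x : 'rV[R]_n) (e : R).

Let cu x : Om x -> {for x, continuous u}. Proof. exact: u2.1. Qed.

Let du x i : Om x -> is_derive x (e_ i) u (partial i u x).
Proof. by move=> Omx; apply: derivableP; exact: (proj1 (u2.2 i) x Omx). Qed.

Let cpu x i : Om x -> {for x, continuous (partial i u)}.
Proof. by move=> Omx; exact: (proj1 (proj2 (u2.2 i)) x Omx). Qed.

Let dpu x i : Om x -> is_derive x (e_ i) (partial i u) (partial i (partial i u) x).
Proof.
move=> Omx; apply: derivableP.
exact: (proj1 (proj2 (proj2 (u2.2 i)) i) x Omx).
Qed.

Let cppu x i : Om x -> {for x, continuous (partial i (partial i u))}.
Proof. by move=> Omx; exact: (proj1 (proj2 (proj2 (proj2 (u2.2 i)) i)) x Omx). Qed.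

(** Boundary points are covered by continuity of u within the closure, and the remaining points have
    a neighbourhood that misses Om. Through [cutoff_eq0] this makes the truncated field vanish near
    every point outside Om. *)
Lemma near_boundary_small e x : 0 < e -> ~ Om x -> \forall y \near x, Om y -> u y <= e.
Proof.
move=> e0 nOmx; have [cx|ncx] := pselect (closure Om x).
  have ux : u x = 0 by apply: u_bd.
  have hux := (subspace_continuousP _ _).1 u0 x cx.
  have ue : u x < e by rewrite ux.
  have := cvgr_lt _ hux _ ue; rewrite near_withinE.
  move=> huy; apply: filterS (huy _) => y h /subset_closure cy; exact: ltW (h cy).
have : \forall y \near x, ~ closure Om y.
  by apply: open_nbhs_nbhs; split=> //; apply: closed_openC; exact: closed_closure.
by apply: filterS => y ncy /subset_closure.
Qed.

Definition truncated_field e i x : R := cutoff e (u x) * partial i u x.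

(** One summand of the divergence, the i-th partial derivative of [truncated_field e i]. Each
    summand integrates to 0 separately, so only pure second derivatives of u occur. *)
Definition truncated_div e i x : R :=
  cutoff1 e (u x) * partial i u x ^+ 2 + cutoff e (u x) * partial i (partial i u) x.

Lemma is_derive_truncated_field e i x : 0 < e ->
  is_derive x (e_ i) (ext0 Om (truncated_field e i)) (ext0 Om (truncated_div e i) x).
Proof.
move=> e0; apply: is_derive_ext0 => // [Omx|nOmx].
  have d1 := is_derive_comp_line (is_derive_cutoff e (u_gt0 Omx)) (du i Omx).
  have d2 := @is_deriveM _ _ _ _ _ _ _ _ d1 (dpu i Omx).
  apply: (@is_derive_eq _ _ _ _ _ _ _ _ d2).
  by rewrite /truncated_div /GRing.scale/=; ring.
apply: filterS (near_boundary_small e0 nOmx) => y h /h uy.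
by rewrite /truncated_field cutoff_eq0// mul0r.
Qed.

Lemma continuous_cutoff_u e x : Om x -> {for x, continuous (fun y => cutoff e (u y))}.
Proof.
move=> Omx.
have ct : {for u x, continuous (cutoff e)}.
  apply: differentiable_continuous; apply/derivable1_diffP.
  by case: (is_derive_cutoff e (u_gt0 Omx)).
exact: (cvg_comp _ _ (cu Omx) ct).
Qed.

Lemma continuous_cutoff1_u e x : Om x -> {for x, continuous (fun y => cutoff1 e (u y))}.
Proof.
move=> Omx.
have ct : {for u x, continuous (cutoff1 e)} by apply: continuous_cutoff1; exact: u_gt0.
exact: (cvg_comp _ _ (cu Omx) ct).
Qed.

Lemma continuous_truncated_div e i x : 0 < e -> {for x, continuous (ext0 Om
  (truncated_div e i))}.
Proof.
move=> e0; move: x; apply: continuous_ext0 => // x Omx.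
  have cX : {for partial i u x, continuous (@GRing.exp R ^~ 2%N)}
    by exact: exprn_continuous.
  have c2 : {for x, continuous (fun y => partial i u y ^+ 2)}.
    exact: (cvg_comp _ _ (cpu Omx) cX).
  exact: (cvgD (cvgM (continuous_cutoff1_u Omx) c2) (cvgM (continuous_cutoff_u Omx)
    (cppu Omx))).
apply: filterS (near_boundary_small e0 Omx) => y h /h uy.
by rewrite /truncated_div cutoff_eq0// cutoff1_eq0// !mul0r addr0.
Qed.

Lemma integral_truncated_div e i : 0 < e ->
  (lebesgue_tuple n).-integrable setT
     (fun s => (ext0 Om (truncated_div e i) (rV_of_tuple s))%:E) /\
  (\int[lebesgue_tuple n]_s (ext0 Om (truncated_div e i) (rV_of_tuple s))%:E = 0)%E.
Proof.
move=> e0.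
have cK : compact (closure Om).
  apply: bounded_closed_compact; last exact: closed_closure.
  apply: bounded_closure; exists `|L|; split=> [|M LM x Omx]; first exact: num_real.
  rewrite /= [leLHS]/Num.Def.normr/= mx_normrE; apply/bigmax_leP.
  split; first by apply: ltW; apply: le_lt_trans LM.
  by move=> [j k] _ /=; rewrite ord1 (le_trans (Om_box k Omx))// (le_trans
    (ler_norm _))// ltW.
have := compact_bounded (continuous_compact (continuous_subspaceT
  (fun x => @continuous_truncated_div e i x e0)) cK).
move=> /ex_strict_bound_gt0[M M0 hM].
have out x j : L < `|x 0 j| -> ~ Om x by move=> Lx /Om_box - /(_ j); rewrite leNgt Lx.
apply: (@integral_compact_partial R n i (ext0 Om (truncated_field e i)) _ L M).
- by move=> x; exact: continuous_truncated_div.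
- by move=> x; exact: is_derive_truncated_field.
- by move=> x j /out nOmx; rewrite !ext0_out.
move=> x; have [Omx|nOmx] := pselect (Om x).
  by apply: ltW; apply: hM; exists x => //; exact: subset_closure.
by rewrite ext0_out// normr0 ltW.
Qed.

Lemma measurable_truncated_energy e :
  measurable_fun setT (fun s : n.-tuple (measurableTypeR R) =>
    ext0 Om (fun x => cutoff1 e (u x) * sqnorm (grad u x)) (rV_of_tuple s)).
Proof.
apply: measurable_continuous_indic => // x Omx.
apply: (cvgM (continuous_cutoff1_u Omx)).
have : {for x, continuous (fun y => \sum_(i < n) partial i u y ^+ 2)}.
  apply: (@cvg_big _ _ _ _ _ _ _ (nbhs x)) => [|i _]; first exact: add_continuous.
  have cX : {for partial i u x, continuous (@GRing.exp R ^~ 2%N)}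
    by exact: exprn_continuous.
  exact: (cvg_comp _ _ (cpu Omx) cX).
rewrite (_ : (fun y => \sum_(i < n) partial i u y ^+ 2) = (fun y => sqnorm (grad u y))) //.
by apply/funext => y; apply: eq_bigr => i _; rewrite mxE.
Qed.

(** With H = [cutoff e], summing [truncated_div] over i gives H'(u) |grad u|^2 + H(u) Lap u, whose
    integral is 0. On Om one has - H(u) Lap u <= H(u) F <= S F, and Om lies in the box, so the
    indicator of the box dominates the remainder by an integrable function. *)
Lemma truncated_energy_le e : 0 < e ->
  (\int[lebesgue_tuple n]_s
     (ext0 Om (fun x => cutoff1 e (u x) * sqnorm (grad u x)) (rV_of_tuple s))%:E <=
   (S * F)%:E * lebesgue_tuple n (@box R L n))%E.
Proof.
move=> e0.
have int_box : (lebesgue_tuple n).-integrable setT (fun s => ((\1_(@box R L n) s)%:E)).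
  apply: (bounded_support_integrable (M :=
    1) (@measurable_box R L n) (@lebesgue_tuple_box R L n)).
  - by apply: measurable_indic; exact: measurable_box.
  - by move=> s; rewrite indicE; case: (_ \in _); rewrite ?normr1 ?normr0.
  - by move=> s ns; rewrite indicE memNset.
have int_div : (lebesgue_tuple n).-integrable setT
   (fun s => \sum_(i < n) (ext0 Om (truncated_div e i) (rV_of_tuple s))%:E)%E.
  by apply: integrable_sum => // i _; case: (integral_truncated_div i e0).
have int_cbox : (lebesgue_tuple n).-integrable setT
    (fun s => (S * F)%:E * (\1_(@box R L n) s)%:E)%E by apply: integrableZl.
apply: (@le_trans _ _ (\int[lebesgue_tuple n]_s
   (\sum_(i < n) (ext0 Om (truncated_div e i) (rV_of_tuple s))%:E +
    (S * F)%:E * (\1_(@box R L n) s)%:E))%E); last first.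
  rewrite integralD// integral_sum//; last by move=> i; case: (integral_truncated_div i e0).
  rewrite big1 ?add0e; last by move=> i _; case: (integral_truncated_div i e0).
  by rewrite integralZl// integral_indic ?setIT//; exact: measurable_box.
have G_ge0 s :
    0 <= ext0 Om (fun x => cutoff1 e (u x) * sqnorm (grad u x)) (rV_of_tuple s).
  have [Oms|nOms] := pselect (Om (rV_of_tuple s)); last by rewrite ext0_out.
  by rewrite ext0_in// mulr_ge0 ?sqnorm_ge0// cutoff1_ge0 ?(ltW e0)// u_gt0.
have G_le s :
    ext0 Om (fun x => cutoff1 e (u x) * sqnorm (grad u x)) (rV_of_tuple s) <=
    \sum_(i < n) ext0 Om (truncated_div e i) (rV_of_tuple s) +
    S * F * \1_(@box R L n) s.
  have [Oms|nOms] := pselect (Om (rV_of_tuple s)); last first.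
    rewrite ext0_out// big1 ?add0r ?mulr_ge0// => i _; exact: ext0_out.
  rewrite ext0_in// (eq_bigr (fun i => truncated_div e i (rV_of_tuple s))); last first.
    by move=> i _; exact: ext0_in.
  have boxs : @box R L n s by move=> i; have := Om_box i Oms; rewrite mxE.
  rewrite indicE mem_set// mulr1.
  set x := rV_of_tuple s; have ux := u_gt0 Oms.
  rewrite /truncated_div big_split/= -!mulr_sumr.
  rewrite (_ : \sum_(i < n) partial i u x ^+ 2 = sqnorm (grad u x)); last first.
    by apply: eq_bigr => i _; rewrite mxE.
  rewrite -[\sum_(i < n) partial i _ x]/(laplacian u x).
  rewrite -addrA lerDl -lerBlDl sub0r -mulrN.
  apply: (@le_trans _ _ (cutoff e (u x) * F)).
    by rewrite ler_wpM2l ?cutoff_ge0 ?(ltW ux)// lerNl lap_ge.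
  by rewrite ler_wpM2r// (le_trans (cutoff_le (ltW e0) ux))// u_le.
apply: ge0_le_integral => //.
- by move=> s _; rewrite lee_fin.
- by apply/measurable_EFinP; exact: measurable_truncated_energy.
- by apply: emeasurable_funD;
  [exact: measurable_int int_div|exact: measurable_int int_cbox].
- by move=> s _; rewrite sumEFin -EFinM -EFinD lee_fin.
Qed.

(** Monotone convergence along e = 1 / (k + 1): [cutoff1 e (u x)] increases to 1 at every point of
    Om, because u > 0 there. *)
Lemma energy_le :
  (\int[lebesgue_tuple n]_s (ext0 Om (fun x => sqnorm (grad u x)) (rV_of_tuple s))%:E <=
   (S * F)%:E * lebesgue_tuple n (@box R L n))%E.
Proof.
pose G k (s : n.-tuple (measurableTypeR R)) :=
  (ext0 Om (fun x => cutoff1 k.+1%:R^-1 (u x) * sqnorm (grad u x)) (rV_of_tuple s))%:E.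
have mG k : measurable_fun setT (G k).
  by apply/measurable_EFinP; exact: measurable_truncated_energy.
have G0 k s : setT s -> (0 <= G k s)%E.
  move=> _; rewrite lee_fin.
  have [Oms|nOms] := pselect (Om (rV_of_tuple s)); last by rewrite ext0_out.
  by rewrite ext0_in// mulr_ge0 ?sqnorm_ge0// cutoff1_ge0 ?invr_ge0// u_gt0.
have ndG s : setT s -> {homo G ^~ s : a b / (a <= b)%N >-> (a <= b)%E}.
  move=> _ j k jk; rewrite lee_fin.
  have [Oms|nOms] := pselect (Om (rV_of_tuple s)); last by rewrite !ext0_out.
  rewrite !ext0_in// ler_wpM2r ?sqnorm_ge0// cutoff1_le ?invr_ge0 ?u_gt0//.
  by rewrite lef_pV2 ?posrE// ler_nat.
have cvgG s : G k s @[k --> \oo] -->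
    (ext0 Om (fun x => sqnorm (grad u x)) (rV_of_tuple s))%:E.
  apply: cvg_EFin; first exact: nearW.
  have [Oms|nOms] := pselect (Om (rV_of_tuple s)); last first.
    rewrite (ext0_out _ nOms) (_ : _ \o _ = cst 0); first exact: cvg_cst.
    by apply/funext => k /=; rewrite ext0_out.
  rewrite (ext0_in _ Oms) (_ : _ \o _ = (fun k =>
    cutoff1 k.+1%:R^-1 (u (rV_of_tuple s)) * sqnorm (grad u (rV_of_tuple s)))); last first.
    by apply/funext => k /=; rewrite ext0_in.
  by rewrite -[X in _ --> X]mul1r; apply: cvgMr_tmp; apply: cvg_cutoff1; exact: u_gt0.
have := cvg_monotone_convergence (mu := lebesgue_tuple n) measurableT mG G0 ndG.
rewrite (eq_integral (fun s => (ext0 Om (fun x => sqnorm (grad u x)) (rV_of_tuple s))%:E));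
  last first.
  by move=> s _; apply/cvg_lim => //; exact: cvgG.
move=> cG; rewrite -(cvg_lim _ cG)//; apply: lime_le; first by apply/cvg_ex; eexists;
  exact: cG.
by apply: nearW => k; apply: truncated_energy_le; rewrite invr_gt0.
Qed.

End energy.

(** * Uniform constants and the two bounds *)

Lemma coord_le_norm {R : realType} {n : nat} (x : 'rV[R]_n) i : `|x 0 i| <= `|x|.
Proof.
rewrite [leRHS]/Num.Def.normr/= mx_normrE; apply/bigmax_geP; right => /=.
by exists (0, i).
Qed.

(** The square root in the norm absorbs the factor 2 of the exponent. No finiteness is assumed,
    since [fine] commutes with powers on all extended reals. *)
Lemma poweR_L2norm {R : realType} {n : nat} (Om : set 'rV[R]_n)
    (v : 'rV[R]_n -> 'rV[R]_n) (alpha : R) :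
  fine (L2norm Om (fun x => enorm (v x))) `^ (2 * alpha) =
  fine (\int[lebesgue_tuple n]_s
     (ext0 Om (fun x => sqnorm (v x)) (rV_of_tuple s))%:E)%E `^ alpha.
Proof.
rewrite /L2norm unlock fine_poweR -powRrM mulrA mulVf// mul1r.
congr (fine _ `^ _); apply: eq_integral => s _.
rewrite abse_EFin poweR_EFin -[2]/(2%:R) powR_mulrn//; congr _%:E.
rewrite real_normK ?num_real// /ext0 exprMn /enorm sqr_sqrtr ?sqnorm_ge0//.
by rewrite indicE; case: (_ \in _); rewrite ?expr1n// expr0n.
Qed.

(** For S > 1 all three powers are at most S^q1, hence S^(1 - q1) <= K (1 + 2 C). The summand 1
    covers the case S <= 1. *)
Lemma sublinear_bound {R : realType} (K C p q q1 S : R) : 0 < K -> 0 <= C ->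
  p <= q1 -> q <= q1 -> q1 < 1 -> 0 <= S ->
  S <= K * (S `^ p + C * (S `^ q + S `^ q1)) ->
  S <= 1 + (K * (1 + 2 * C)) `^ (1 - q1)^-1.
Proof.
move=> K0 C0 pq1 qq1 q11 S0 SK.
have A0 : 0 <= K * (1 + 2 * C) by rewrite mulr_ge0 ?(ltW K0)// addr_ge0// mulr_ge0.
have [S1|S1] := leP S 1; first by rewrite (le_trans S1)// lerDl powR_ge0.
rewrite (@le_trans _ _ ((K * (1 + 2 * C)) `^ (1 - q1)^-1))//; last by rewrite lerDr.
have q1' : 0 < 1 - q1 by rewrite subr_gt0.
rewrite -[leLHS]powRr1// -[in leLHS](mulfV (lt0r_neq0 q1')) powRrM.
apply: ge0_ler_powR; rewrite ?nnegrE ?powR_ge0// ?invr_ge0 ?(ltW q1')//.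
have Sq1 : 0 < S `^ q1 by rewrite powR_gt0// (lt_trans _ S1).
rewrite -(ler_pM2r Sq1) -powRD; last by rewrite subrK oner_eq0.
rewrite subrK powRr1//; apply: (le_trans SK); rewrite -mulrA ler_pM2l//.
have hp : S `^ p <= S `^ q1 by apply: ler_powR => //; exact: ltW.
have hq : S `^ q <= S `^ q1 by apply: ler_powR => //; exact: ltW.
rewrite mulrDl mul1r lerD// -mulrA mulrCA ler_wpM2l//.
by rewrite mulr_natl mulr2n lerD2r.
Qed.

Theorem theorem3p7 (R : realType) (N : nat) (N_ge2 : (2 <= N)%N)
  (Om : set 'rV[R]_N) (Om_dom : bounded_smooth_domain Om)
  (a b alpha p : R) (a_gt0 : 0 < a) (b_gt0 : 0 < b)
  (alpha_gt0 : 0 < alpha)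
  (alpha_lt : (alpha%:E < (two_star R N - 1) * (2^-1)%:E)%E)
  (p_gt0 : 0 < p) (p_lt1 : p < 1)
  (h : 'rV[R]_N -> R -> 'rV[R]_N -> R)
  (h_hoelder : hoelder_on
     [set z : 'rV[R]_N * R * 'rV[R]_N | closure Om z.1.1 /\ 0 < z.1.2]
     (fun z => h z.1.1 z.1.2 z.2))
  (h_ge0 : forall x s xi, closure Om x -> 0 < s -> 0 <= h x s xi)
  (h_lim0 : forall e : R, 0 < e -> \forall s \near 0^'+,
     forall x xi, closure Om x -> `|h x s xi / s `^ p| < e)
  (C q q1 : R) (C_gt0 : 0 < C) (p_lt_q : p < q) (q_le_q1 : q <= q1)
  (q1_lt1 : q1 < 1)
  (h_growth : forall x s xi, closure Om x -> 0 < s ->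
     `|h x s xi| <= C * (s `^ q + s `^ q1)) :
  exists r Rad : R, [/\ 0 < r, 0 < Rad &
    forall (t : R) (u : 'rV[R]_N -> R), 0 <= t -> t <= 1 ->
      is_solution Om a b alpha p h t u ->
      r <= supnorm Om u /\ supnorm Om u <= Rad].
Proof.
have N_gt0 : (0 < N)%N by exact: ltn_trans N_ge2.
case: Om_dom => Om_ne Om_open _ Om_bd _.
have [L L_gt0 Om_L] : exists2 L : R,
    0 < L & forall x i, closure Om x -> `|x 0 i| <= L.
  have /ex_strict_bound_gt0[L L0 hL] := bounded_closure Om_bd.
  exists L => // x i cx; apply: le_trans (coord_le_norm _ _) _; exact: ltW (hL _ cx).
pose D : R := N%:R * L ^+ 2.
have D_gt0 : 0 < D by rewrite mulr_gt0 ?ltr0n// exprn_gt0.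
have Om_D x : closure Om x -> sqnorm x <= D.
  move=> cx; apply: (@le_trans _ _ (\sum_(i < N) L ^+ 2)).
    apply: ler_sum => i _; rewrite -real_normK ?num_real// ler_pXn2r ?nnegrE ?(ltW L_gt0)//.
    exact: Om_L.
  by rewrite sumr_const card_ord /D mulr_natl.
pose G (s : R) := s `^ p + C * (s `^ q + s `^ q1).
have q_gt0 : 0 < q by exact: lt_trans p_lt_q.
have q1_gt0 : 0 < q1 by exact: lt_le_trans q_le_q1.
have G_gt0 s : 0 < s -> 0 < G s.
  move=> s0; rewrite /G addr_gt0 ?powR_gt0// mulr_gt0// addr_gt0 ?powR_gt0//.
have G_le s s' : 0 <= s -> s <= s' -> G s <= G s'.
  move=> s0 ss; have s0' := le_trans s0 ss.
  have pow_le k : 0 < k -> s `^ k <= s' `^ k.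
    by move=> k0; apply: ge0_ler_powR; rewrite ?nnegrE// ltW.
  rewrite /G; apply: lerD; first exact: pow_le.
  by rewrite ler_pM2l//; apply: lerD; exact: pow_le.
(* Comparison will give S <= (G S / a) D = K G S, and [Rad] is what [sublinear_bound] extracts from
   this. *)
pose K := D / a.
have K_gt0 : 0 < K by rewrite divr_gt0.
pose Rad := 1 + (K * (1 + 2 * C)) `^ (1 - q1)^-1.
have Rad_gt0 : 0 < Rad by rewrite ltr_wpDr// powR_ge0.
(* [E] is the energy bound with S replaced by [Rad], and [m0] is the coefficient at t = 1 with
   energy [E]. Everything is fixed before t and u are introduced, which makes r and Rad uniform. *)
pose B := fine (lebesgue_tuple N (@box R L N)).
pose E := Rad * (G Rad / a) * B.
pose m0 := a + b * E `^ alpha.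
have m0_gt0 : 0 < m0 by rewrite ltr_wpDr// mulr_ge0 ?powR_ge0// ltW.
have [r r_gt0 r_lower] := supersolution_lower_bound N_gt0 Om_open Om_ne p_gt0 p_lt1 m0_gt0.
exists r, Rad; split=> // t u t0 t1 [u2 u0 _ u_eq u_gt0 u_bd].
pose m := a + t * b * fine (L2norm Om (fun x => enorm (grad u x))) `^ (2 * alpha).
have m_ge : a <= m by rewrite lerDl !mulr_ge0 ?powR_ge0// ltW.
have m_gt0 : 0 < m by exact: lt_le_trans m_ge.
pose S := supnorm Om u.
have cK : compact (closure Om).
  by apply: bounded_closed_compact; [exact: bounded_closure|exact: closed_closure].
(* [sup] takes a default value on sets without a supremum, so boundedness of u on Om has to be
   established before [supnorm] can be used. *)
have S_sup : has_sup [set `|u x| | x in Om].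
  split; first by case: Om_ne => x Omx; exists `|u x|, x.
  have /ex_strict_bound_gt0[M M0 hM] := compact_bounded (continuous_compact u0 cK).
  exists M => _ [x Omx <-]; apply: ltW; apply: hM; exists x => //.
  exact: subset_closure.
have u_le x : Om x -> u x <= S.
  move=> Omx; apply: le_trans (ler_norm _) _; apply: sup_upper_bound => //.
  by exists x.
have S_gt0 : 0 < S.
  by case: Om_ne => x Omx; exact: lt_le_trans (u_gt0 _ Omx) (u_le _ Omx).
have h_u x : Om x -> 0 <= h x (u x) (grad u x) <= C * (u x `^ q + u x `^ q1).
  move=> Omx; have cx := subset_closure Omx; rewrite h_ge0 ?u_gt0//=.
  by apply: le_trans (ler_norm _) _; apply: h_growth => //; exact: u_gt0.
have lap_ge x : Om x -> - (G S / a) <= laplacian u x.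
  move=> Omx; have /andP[h0 h1] := h_u x Omx.
  have GS := G_le _ _ (ltW (u_gt0 _ Omx)) (u_le _ Omx).
  have e1 : - m * laplacian u x <= G S.
    rewrite (u_eq x Omx); apply: le_trans GS; rewrite /G lerD2l.
    by apply: le_trans h1; rewrite ler_piMl.
  (* The inequality m >= a helps only where the Laplacian is negative; elsewhere the bound is
     trivial since G S > 0. *)
  have [l0|l0] := leP 0 (laplacian u x).
    by apply: le_trans l0; rewrite oppr_le0 divr_ge0 ?(ltW a_gt0)// ltW// G_gt0.
  rewrite lerNl ler_pdivlMr// mulrC; apply: le_trans e1.
  by rewrite mulNr -mulrN ler_wpM2r// oppr_ge0 ltW.
have GSa : 0 < G S / a by rewrite divr_gt0// G_gt0.
have u_upper x : Om x -> u x <= G S / a * D.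
  apply: (laplacian_ge_upper_bound N_gt0 Om_open Om_bd u2 u0 GSa lap_ge Om_D).
  by move=> y /u_bd ->.
have S_le : S <= Rad.
  apply: (sublinear_bound K_gt0 (ltW C_gt0) (ltW
    (lt_le_trans p_lt_q q_le_q1)) q_le_q1 q1_lt1 (ltW S_gt0)).
  apply: sup_le_ub; first by case: S_sup.
  move=> _ [x Omx <-]; rewrite gtr0_norm ?u_gt0//.
  by rewrite mulrC /K mulrA mulrAC; exact: u_upper.
split; last exact: S_le.
have int_le : fine (\int[lebesgue_tuple N]_s
     (ext0 Om (fun x => sqnorm (grad u x)) (rV_of_tuple s))%:E)%E <= E.
  have box_fin : lebesgue_tuple N (@box R L N) \is a fin_num.
    by rewrite ge0_fin_numE// lebesgue_tuple_box.
  have := energy_le Om_open u2 u0 u_bd u_gt0 u_le (ltW S_gt0) (ltW GSa) lap_ge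
    (fun x i Omx => Om_L x i (subset_closure Omx)).
  rewrite -(fineK box_fin) -/B -EFinM => int_le.
  (* The estimate itself shows that the integral is finite, which is what removing [fine]
     requires. *)
  apply: (@le_trans _ _ (S * (G S / a) * B)).
    rewrite -lee_fin fineK// ge0_fin_numE ?(le_lt_trans int_le) ?ltry//.
    apply: integral_ge0 => s _; rewrite lee_fin /ext0 mulr_ge0 ?sqnorm_ge0//.
  rewrite /E ler_wpM2r ?fine_ge0// ler_pM// ?(ltW S_gt0) ?(ltW GSa)//.
  by rewrite ler_pM2r ?invr_gt0// G_le// ltW.
have m_le : m <= m0.
  rewrite /m /m0 poweR_L2norm lerD2l -mulrA.
  set X := fine _ in int_le *.
  have X_ge0 : 0 <= X.
    apply: fine_ge0; apply: integral_ge0 => s _.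
    by rewrite lee_fin /ext0 mulr_ge0 ?sqnorm_ge0.
  apply: (@le_trans _ _ (b * X `^ alpha)).
    by rewrite ler_piMl// mulr_ge0 ?powR_ge0// ltW.
  rewrite ler_pM2l//; apply: ge0_ler_powR => //; first exact: ltW.
  by rewrite nnegrE (le_trans X_ge0).
have [x Omx rx] : exists2 x, Om x & r <= u x.
  apply: r_lower => // x Omx; have /andP[h0 _] := h_u x Omx.
  have e1 : u x `^ p <= - m * laplacian u x.
    by rewrite (u_eq x Omx) lerDl mulr_ge0.
  (* Replacing m by the larger m0 is legitimate only for a nonnegative factor; the sign comes from
     u^p >= 0 and m > 0. *)
  have l0 : 0 <= - laplacian u x.
    by rewrite -(pmulr_rge0 _ m_gt0) mulrN -mulNr (le_trans _ e1)// powR_ge0.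
  by apply: (le_trans e1); rewrite !mulNr -!mulrN ler_wpM2r.
exact: le_trans rx (u_le x Omx).
Qed.
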